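(* Let $p,q$ be real numbers with $0\le p\le 1$ and $q=1-p$. Then $$2H(p,q)=(p^2+q^2)\,H\!\left(\frac{p^2}{p^2+q^2},\frac{q^2}{p^2+q^2}\right)+2pq+H(p^2+q^2,\,2pq).$$
   Context: All logarithms are to base $2$. For non-negative reals $u,v$ with $u+v=1$, $H(u,v)=u\log\frac1u+v\log\frac1v$ is the Shannon entropy function, with the convention $0\log\frac10=0$. *)

(* Defs.v *)
From Stdlib Require Import Reals.
Local Open Scope R_scope.

(** Binary Shannon entropy, meant for [0 <= u], [0 <= v], [u + v = 1]. The convention
    [0 * log (1/0) = 0] needs no case split: [1 / 0] and [Rlog] are total, and the
    product with the factor [0] is [0] whatever their value. *)
Definition H (u v : R) : R := u * Rlog 2 (1 / u) + v * Rlog 2 (1 / v).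

(* Main.v *)
(** The function [eta u = u log (1/u)] is a derivation on the non-negative reals:
    [eta (a b) = a eta b + b eta a], also when a factor vanishes. Hence
    [s H(a/s, b/s) = eta a + eta b - eta s] whenever [s = a + b > 0], and expanding
    [eta (p^2)], [eta (q^2)] and [eta (2pq)], with [eta 2 = -2], leaves
    [2 (p + q) (eta p + eta q)]. *)
Require Import Defs.
From Stdlib Require Import Reals Lra.
Local Open Scope R_scope.

Definition eta (u : R) : R := u * Rlog 2 (1 / u).

Lemma ln2_neq0 : ln 2 <> 0.
Proof. pose proof ln_lt_2; lra. Qed.

(** At [u = 0] both sides carry the factor 0, so the value of [ln 0] is irrelevant. *)
Lemma eta_ln (u : R) : 0 <= u -> eta u = - (u * ln u) / ln 2.
Proof.
  pose proof ln2_neq0 as Hl.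
  intros [Hu | <-]; unfold eta, Rlog.
  - replace (1 / u) with (/ u) by (field; lra).
    rewrite ln_Rinv by assumption; field; exact Hl.
  - field; exact Hl.
Qed.

Lemma eta_mul (a b : R) : 0 <= a -> 0 <= b -> eta (a * b) = a * eta b + b * eta a.
Proof.
  pose proof ln2_neq0 as Hl.
  intros Ha Hb.
  rewrite !eta_ln by (try apply Rmult_le_pos; assumption).
  destruct Ha as [Ha | <-]; [destruct Hb as [Hb | <-] |].
  - rewrite ln_mult by assumption; field; exact Hl.
  - field; exact Hl.
  - field; exact Hl.
Qed.

Lemma eta_sqr (a : R) : 0 <= a -> eta (a ^ 2) = 2 * a * eta a.
Proof.
  intros Ha; replace (a ^ 2) with (a * a) by ring.
  rewrite eta_mul by assumption; ring.
Qed.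

Lemma eta_2 : eta 2 = -2.
Proof. rewrite eta_ln by lra; field; exact ln2_neq0. Qed.

Lemma H_normalized (a b : R) : 0 <= a -> 0 <= b -> 0 < a + b ->
  (a + b) * H (a / (a + b)) (b / (a + b)) = eta a + eta b - eta (a + b).
Proof.
  intros Ha Hb Hs.
  (* Derivation rule for [c = (a + b) * (c / (a + b))]; for [c = a] and [c = b] the weights
     [c / (a + b)] sum to 1. *)
  assert (scale : forall c, 0 <= c ->
    eta c = (a + b) * eta (c / (a + b)) + c / (a + b) * eta (a + b)).
  { intros c Hc; rewrite <- eta_mul.
    - f_equal; field; lra.
    - lra.
    - apply Rle_mult_inv_pos; assumption. }
  rewrite (scale a Ha), (scale b Hb).
  change (H ?u ?v) with (eta u + eta v).
  field; lra.
Qed.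

Theorem mainTheorem1 (p q : R) (hp : 0 <= p <= 1) (hq : q = 1 - p) :
  2 * H p q =
  (p ^ 2 + q ^ 2) * H (p ^ 2 / (p ^ 2 + q ^ 2)) (q ^ 2 / (p ^ 2 + q ^ 2))
  + 2 * p * q
  + H (p ^ 2 + q ^ 2) (2 * p * q).
Proof.
  assert (Hp : 0 <= p) by lra.
  assert (Hq : 0 <= q) by lra.
  (* [p ^ 2 + (1 - p) ^ 2] is at least 1/2, hence positive. *)
  rewrite H_normalized; [| apply pow2_ge_0 | apply pow2_ge_0 | subst q; nra].
  change (H ?u ?v) with (eta u + eta v).
  rewrite !eta_sqr by assumption.
  replace (2 * p * q) with (2 * (p * q)) by ring.
  rewrite (eta_mul 2 (p * q)), (eta_mul p q), eta_2
    by (try apply Rmult_le_pos; lra).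
  (* Both [eta (p ^ 2 + q ^ 2)] terms cancel, as does [2 * p * q] against the term from [eta 2]. *)
  subst q; ring.
Qed.
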